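(* As $|R|\to\infty$, the proportion of mapical regular representations (MRRs) among labelled Cayley maps on $R$ tends to $1$. That is: for every $\varepsilon>0$ there exists $N$ such that for every finite group $R$ with $|R|\ge N$, $$\frac{\#\{(S,\mathfrak r) : CM(R,S,\mathfrak r)\text{ is a Cayley map on } R \text{ and is an MRR}\}}{\#\{(S,\mathfrak r) : CM(R,S,\mathfrak r)\text{ is a Cayley map on } R\}}>1-\varepsilon .$$
   Context: All groups and graphs are finite. A graph $\Gamma=(V,E)$ has a finite non-empty vertex set $V$ and a set $E$ of $2$-subsets of $V$; $\Gamma(v)=\{w\in V:\{v,w\}\in E\}$ is the neighbourhood of $v$. A cyclic ordering on a finite set is a permutation of that set with no fixed points and a single cycle in its cycle decomposition. A rotation on $\Gamma$ is a family $\rho=(\rho_v)_{v\in V}$ where each $\rho_v$ is a cyclic ordering of $\Gamma(v)$. A map is a pair $(\Gamma,\rho)$ with $\Gamma$ a connected graph and $\rho$ a rotation on $\Gamma$. Automorphisms act on the right ($x^\varphi$ is the image of $x$ under $\varphi$). An automorphism of a map $(\Gamma,\rho)$ is an automorphism $\varphi$ of the graph $\Gamma$ (a permutation of $V$ preserving $E$) such that $\rho_{v^\varphi}=\varphi^{-1}\rho_v\varphi$ for all $v\in V$, i.e. whenever $\rho_v$ takes $u$ to $w$, $\rho_{v^\varphi}$ takes $u^\varphi$ to $w^\varphi$. Let $R$ be a finite group with identity $e$, let $S\subseteq R\setminus\{e\}$ be a generating set of $R$ with $S=S^{-1}$, and let $\mathfrak r:S\to S$ be a cyclic ordering on $S$.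 The Cayley graph $\mathrm{Cay}(R,S)$ has vertex set $R$, with $\{g,t\}$ an edge if and only if $tg^{-1}\in S$. The Cayley map $CM(R,S,\mathfrak r)$ is the map $(\Gamma,\rho)$ with $\Gamma=\mathrm{Cay}(R,S)$ and $\rho_g(x)=\mathfrak r(xg^{-1})\,g$ for $g\in R$ and $x\in\Gamma(g)$; it is the unique map on $\Gamma$ with rotation $\mathfrak r$ at $e$ such that right multiplication by each element of $R$ is a map automorphism. Thus the right regular representation of $R$ is contained in $\mathrm{Aut}(CM(R,S,\mathfrak r))$. $CM(R,S,\mathfrak r)$ is a mapical regular representation (MRR) if $\mathrm{Aut}(CM(R,S,\mathfrak r))\cong R$; equivalently, the only automorphism of the map fixing a vertex is the identity. Labelled Cayley maps: two Cayley maps $CM(R,S,\mathfrak r)$ and $CM(R,S',\mathfrak r')$ over the same group are considered the same if and only if $S=S'$ and $\mathfrak r=\mathfrak r'$. *)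

(* Defs.v *)
From HB Require Import structures.
From mathcomp Require Import all_boot all_order all_algebra all_fingroup.
From mathcomp Require Import reals.

Set Implicit Arguments.
Unset Strict Implicit.
Unset Printing Implicit Defensive.

Import GroupScope.

(* A permutation of a subset A of T is encoded as its extension by the identity
   to a permutation of T; this is a bijection between the permutations of A
   and the r : {perm T} with perm_on A r. A cyclic ordering has exactly one
   cycle on A and no fixed point in A, so none exists when #|A| <= 1. *)
Definition cyclic_ordering (T : finType) (A : {set T}) (r : {perm T}) : bool :=
  [&& perm_on A r, [forall x in A, r x != x] & #|[set porbit r x | x in A]| == 1%N].

Section Maps.

Variable V : finType.

(* The data of a pair (Gamma, rho); its axioms are collected in is_map, where a
   set of 2-subsets of V is read as a symmetric irreflexive relation. *)
Record premap := Premap { adj : rel V; rot : V -> {perm V} }.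

Definition neighb (M : premap) (v : V) : {set V} := [set w | adj M v w].

Definition is_map (M : premap) : Prop :=
  [/\ 0 < #|V|, symmetric (adj M) /\ irreflexive (adj M),
      forall u v, connect (adj M) u v
    & forall v, cyclic_ordering (neighb M v) (rot M v)].

(* In {perm V} composition is read from left to right and x ^ f = f^-1 * x * f,
   so the second clause is rho_(v^f) = f^-1 rho_v f. *)
Definition map_aut (M : premap) : {set {perm V}} :=
  [set f : {perm V} | [forall u, forall v, adj M (f u) (f v) == adj M u v]
                      && [forall v, rot M (f v) == rot M v ^ f]].

Lemma map_autP (M : premap) (f : {perm V}) :
  reflect ((forall u v, adj M (f u) (f v) = adj M u v)
           /\ (forall v, rot M (f v) = rot M v ^ f))
          (f \in map_aut M).
Proof.
rewrite inE; apply: (iffP andP) => -[Ha Hr]; split.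
- by move=> u v; move/forallP/(_ u)/forallP/(_ v)/eqP: Ha.
- by move=> v; move/forallP/(_ v)/eqP: Hr.
- by apply/forallP=> u; apply/forallP=> v; rewrite Ha.
- by apply/forallP=> v; rewrite Hr.
Qed.

Lemma map_aut_group_set (M : premap) : group_set (map_aut M).
Proof.
apply/group_setP; split=> [|f g /map_autP[fa fr] /map_autP[ga gr]].
  by apply/map_autP; split=> [u v|v]; rewrite ?perm1 ?conjg1.
by apply/map_autP; split=> [u v|v]; rewrite !permM ?ga ?fa // gr fr conjgM.
Qed.

Canonical map_aut_group (M : premap) : {group {perm V}} :=
  Group (map_aut_group_set M).

End Maps.

Section CayleyMaps.

Variable R : finGroupType.

Definition cayley_adj (S : {set R}) : rel R := fun g t => t * g^-1 \in S.

Lemma cayley_rot_inj (r : {perm R}) (g : R) :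
  injective (fun x => r (x * g^-1) * g).
Proof. by move=> x y /mulIg/perm_inj/mulIg. Qed.

(* When perm_on S r, this perm fixes every point outside the neighbourhood of g,
   since then x * g^-1 \notin S. *)
Definition cayley_rot (r : {perm R}) (g : R) : {perm R} :=
  perm (@cayley_rot_inj r g).

Definition cayley_map (S : {set R}) (r : {perm R}) : premap R :=
  Premap (cayley_adj S) (cayley_rot r).

Definition cayley_pair (S : {set R}) (r : {perm R}) : bool :=
  [&& 1 \notin S, <<S>> == [set: R], S^-1 == S & cyclic_ordering S r].

Definition is_MRR (S : {set R}) (r : {perm R}) : bool :=
  map_aut (cayley_map S r) \isog [set: R].

Definition cayley_maps : {set {set R} * {perm R}} :=
  [set Sr | cayley_pair Sr.1 Sr.2].

Definition MRRs : {set {set R} * {perm R}} :=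
  [set Sr in cayley_maps | is_MRR Sr.1 Sr.2].

Lemma cayley_rotE (r : {perm R}) (g : R) :
  cayley_rot r g = r ^ perm (@mulIg R g).
Proof.
apply/permP=> x; rewrite permE -{2}[x](mulgKV g) conjgE !permM.
have -> : x * g^-1 * g = perm (@mulIg R g) (x * g^-1) by rewrite permE.
by rewrite permK permE.
Qed.

Lemma cyclic_orderingJ (T : finType) (A : {set T}) (r f : {perm T}) :
  cyclic_ordering A r -> cyclic_ordering (f @: A) (r ^ f).
Proof.
have rJ x : (r ^ f) (f x) = f (r x) by rewrite conjgE !permM permK.
have rJn n x : ((r ^ f) ^+ n) (f x) = f ((r ^+ n) x).
  by rewrite -conjXg conjgE !permM permK.
case/and3P=> /subsetP Ar /forall_inP nofix /eqP one; apply/and3P; split.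
- apply/subsetP=> x; rewrite !inE -[x](permKV f) rJ (inj_eq perm_inj) => rx.
  by apply: imset_f; apply: Ar; rewrite inE.
- by apply/forall_inP=> _ /imsetP[x Ax ->]; rewrite rJ (inj_eq perm_inj) nofix.
have pJ x : porbit (r ^ f) (f x) = f @: porbit r x.
  apply/setP=> y; apply/porbitP/imsetP=> [[n ->]|[_ /porbitP[n ->] ->]].
    by exists ((r ^+ n) x); rewrite ?mem_porbit.
  by exists n.
rewrite -imset_comp (eq_imset _ pJ) (imset_comp (fun X : {set T} => f @: X)).
by rewrite card_imset ?one //; apply: imset_inj; apply: perm_inj.
Qed.

Lemma cayley_map_is_map (S : {set R}) (r : {perm R}) :
  cayley_pair S r -> is_map (cayley_map S r).
Proof.
case/and4P=> S1 /eqP genS /eqP SV cycr; split.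
- by apply/card_gt0P; exists 1.
- split=> [g t|g] /=; rewrite /cayley_adj; last by rewrite mulgV (negPf S1).
  by rewrite -{1}SV inE invMg invgK.
- move=> u v; have: v * u^-1 \in <<S>> by rewrite genS inE.
  case/gen_prodgP=> n [c Sc def]; move: def => /(canRL (mulgKV _)) ->.
  elim: n c Sc => [|n IH] c Sc; first by rewrite big_ord0 mul1g connect0.
  rewrite big_ord_recl -mulgA.
  apply: connect_trans (IH _ (fun i => Sc (lift ord0 i))) _.
  by apply: connect1; rewrite /= /cayley_adj mulgK.
move=> g /=; rewrite cayley_rotE.
have -> : neighb (cayley_map S r) g = perm (@mulIg R g) @: S.
  apply/setP=> x; rewrite inE /= /cayley_adj.
  apply/idP/imsetP=> [Sx|[s Ss ->]]; last by rewrite permE mulgK.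
  by exists (x * g^-1); rewrite // permE mulgKV.
exact: cyclic_orderingJ.
Qed.

Lemma right_mul_map_aut (S : {set R}) (r : {perm R}) (g : R) :
  perm (@mulIg R g) \in map_aut (cayley_map S r).
Proof.
apply/map_autP; split=> [u v|v] /=.
  by rewrite /cayley_adj !permE invMg mulgA mulgK.
rewrite !cayley_rotE -conjgM permE; congr (r ^ _).
by apply/permP=> x; rewrite permM !permE mulgA.
Qed.

End CayleyMaps.

(* Main.v *)
Require Import Defs.
From HB Require Import structures.
From mathcomp Require Import all_boot all_order all_algebra all_fingroup.
From mathcomp Require Import cyclic reals zify lra.

Set Implicit Arguments.
Unset Strict Implicit.
Unset Printing Implicit Defensive.

(** Most Cayley maps are MRRs because an extra automorphism is a very rigid
object, so rigid that it does not survive a small change of the rotation.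

Let k = |S|, let the cyclic ordering r of S define a Cayley map, and let f be a
nontrivial automorphism fixing 1. On S, f commutes with r, so f acts there as a
power of r. The same holds at every vertex a: the permutation
s |-> f (s a) (f a)^-1 of S commutes with r and is again a power q of r
(map_aut_local), so that

    f (s a) = q s * f a   for s in S, with q depending on a only.

When S contains more than half of R, f is determined by its action on S
(map_aut_fix). Replacing f by a power of itself, it may be assumed that
f = r^(k/p) on S for a prime p dividing k (skew_power_of_not_MRR).

Now suppose that |S| > |R \ S| + 12, that r and a conjugate r^t both satisfy
this identity with the same exponent i = k/p, and that t moves at most three
points. Then r^i and (r^t)^i agree on almost all of R, which forces the powers q
belonging to r and to r^t at a well chosen vertex a to have the same exponent;
the identity then transfers the agreement to every point, so that t commutes
with r^i (skew_power_rigid). Fix y in S. It follows that (r, z) |-> r^(y z) is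
injective on the pairs in which r satisfies the identity and z is not y or one
of its neighbours under r^i. Hence at most a proportion 1/(k-3) of the cyclic
orderings of S satisfies it (card_skew_orderings). The number of primes p
dividing k is at most sqrt(2k), so for each such S the proportion of non-MRRs is
O(1/sqrt k), uniformly (card_non_MRR_orderings).

The remaining S have at most |R|/2 + 6 elements. There are at most 2^|R| of them,
each with at most (|R|/2 + 6)! cyclic orderings, which is negligible against the
(|R|-2)! Cayley maps with S = R \ {1} (fact_half_small,
card_cayley_maps_ge). *)

(** * Finite sets *)

Lemma exists_notin (T : finType) (Bs : seq {set T}) :
  \sum_(B <- Bs) #|B| < #|T| -> exists x, all (fun B : {set T} => x \notin B) Bs.
Proof.
move=> small; suff [x] : exists x, x \notin \bigcup_(B <- Bs) B.
  by move=> x_out; exists x; move: x_out; elim: (Bs) => [|B s IH];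
    rewrite ?big_nil // big_cons inE negb_or /= => /andP[-> /IH].
apply/existsP; rewrite -negb_forall; apply: contraL small => /forallP all_in.
rewrite -leqNgt -cardsT; have -> : [set: T] = \bigcup_(B <- Bs) B.
  by apply/setP=> x; rewrite inE all_in.
elim: (Bs) => [|B s IH]; rewrite ?big_nil ?cards0 // !big_cons.
exact: leq_trans (leq_card_setU _ _) (leq_add _ _).
Qed.

Lemma card_dep_pairs (A B : finType) (P : pred A) (F : A -> {set B}) :
  #|[set u : A * B | P u.1 && (u.2 \in F u.1)]| = \sum_(a | P a) #|F a|.
Proof.
rewrite -sum1dep_card.
rewrite -(pair_big_dep _ (fun a b => b \in F a) (fun _ _ => 1%N)) /=.
by apply: eq_bigr => a _; rewrite sum1_card.
Qed.

(** * Cyclic orderings *)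

Section CyclicOrderings.

Variable T : finType.
Implicit Types (S : {set T}) (r q : {perm T}) (x y : T).
Import GroupScope.

Definition orderings S : {set {perm T}} := [set r | cyclic_ordering S r].

Lemma cyclic_ordering_on S r : cyclic_ordering S r -> perm_on S r.
Proof. by case/and3P. Qed.

Lemma perm_on_cycle S r q : perm_on S r -> q \in <[r]> -> perm_on S q.
Proof.
move=> Sr; have : <[r]> \subset Sym S by rewrite cycle_subG inE.
by move/subsetP=> sub /sub; rewrite inE.
Qed.

Lemma cyclic_ordering_porbit S r x :
  cyclic_ordering S r -> x \in S -> porbit r x = S.
Proof.
move=> cr Sx; have Sr := cyclic_ordering_on cr.
case/and3P: cr => _ _ /cards1P[P defP].
have orbP y : y \in S -> porbit r y = P.
  by move=> Sy; apply/set1P; rewrite -defP imset_f.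
apply/setP=> y; apply/idP/idP=> [/porbitP[i ->]|Sy].
  by rewrite perm_closed // (perm_on_cycle Sr) ?mem_cycle.
by rewrite (orbP x) // -(orbP y) // porbit_id.
Qed.

Lemma cyclic_ordering_trans S r x y :
  cyclic_ordering S r -> x \in S -> y \in S -> exists i, y = (r ^+ i) x.
Proof.
by move=> cr Sx Sy; apply/porbitP; rewrite (cyclic_ordering_porbit cr).
Qed.

(** A self-map of S commuting with a transitive cyclic action is determined by
the image of one point, which some power of r also realises. *)
Lemma cyclic_ordering_centralizer S r (f : T -> T) :
    cyclic_ordering S r -> {in S, forall x, f x \in S} ->
    {in S, forall x, f (r x) = r (f x)} ->
  exists2 q, q \in <[r]> & {in S, f =1 q}.
Proof.
move=> cr fS fr; have Sr := cyclic_ordering_on cr.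
have [->|[x Sx]] := set_0Vmem S.
  by exists 1 => // x; rewrite inE.
have [i def_i] := cyclic_ordering_trans cr Sx (fS x Sx).
exists (r ^+ i); first exact: mem_cycle.
move=> _ /(cyclic_ordering_trans cr Sx)[j ->].
elim: j => [|j IH]; first by rewrite expg0 perm1.
rewrite expgSr permM fr ?IH; last first.
  by rewrite perm_closed // (perm_on_cycle Sr) ?mem_cycle.
by rewrite -!permM -expgSr -expgS.
Qed.

(** The powers of r act semiregularly on S: they commute with each other and r is
transitive. *)
Lemma cyclic_ordering_free S r q q' x :
    cyclic_ordering S r -> q \in <[r]> -> q' \in <[r]> -> x \in S ->
  q x = q' x -> q = q'.
Proof.
move=> cr rq rq' Sx eq_x; have Sr := cyclic_ordering_on cr.
apply/permP=> y; have [Sy|S'y] := boolP (y \in S); last first.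
  by rewrite !(out_perm (perm_on_cycle Sr _)).
have [i ->] := cyclic_ordering_trans cr Sx Sy.
have comm p : p \in <[r]> -> p ((r ^+ i) x) = (r ^+ i) (p x).
  by case/cycleP=> j ->; rewrite -!permM -!expgD addnC.
by rewrite !comm ?eq_x.
Qed.

Lemma order_cyclic_ordering S r :
  cyclic_ordering S r -> S != set0 -> #[r] = #|S|.
Proof.
move=> cr /set0Pn[x Sx].
rewrite -(cyclic_ordering_porbit cr Sx) porbit.unlock card_in_imset //.
by move=> q q' rq rq'; apply: (cyclic_ordering_free cr).
Qed.

(** The successor function of any enumeration of S will do. *)
Lemma cyclic_ordering_exists S : (1 < #|S|)%N -> exists r, cyclic_ordering S r.
Proof.
move=> S_gt1; pose c := enum S.
have Uc : uniq c by apply: enum_uniq.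
have in_c x : (x \in c) = (x \in S) by rewrite mem_enum.
pose r := perm (can_inj (prev_next Uc)).
have c_next : fcycle (next c) c by apply: cycle_next.
have rE n x : (r ^+ n) x = iter n (next c) x.
  by rewrite permX; apply: eq_iter => y; rewrite permE.
have orb x : x \in S -> porbit r x = S.
  move=> Sx; apply/setP=> y; rewrite -(in_c y).
  rewrite -(@fconnect_cycle _ _ _ c_next x) ?in_c //.
  apply/porbitP/idP=> [[i ->]|/iter_findex <-].
    by rewrite rE fconnect_iter.
  by exists (findex (next c) x y); rewrite rE.
exists r; apply/and3P; split.
- apply/subsetP=> x; rewrite inE permE -in_c => /eqP nx.
  by apply/negPn/negP=> c'x; apply: nx; rewrite next_nth (negPf c'x).
- apply/forall_inP=> x Sx; apply: contraL S_gt1 => /eqP rx.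
  rewrite -leqNgt -(orb x Sx) -[leqRHS](cards1 x) subset_leq_card //.
  apply/subsetP=> _ /porbitP[i ->]; rewrite inE.
  by elim: i => [|i /eqP IH]; rewrite ?expg0 ?perm1 // expgSr permM IH rx.
have [x Sx] : exists x, x \in S by apply/set0Pn; rewrite -card_gt0 ltnW.
apply/cards1P; exists S; apply/setP=> P; rewrite inE.
apply/imsetP/eqP=> [[y Sy ->]|->]; first exact: orb.
by exists x; rewrite ?orb.
Qed.

(** Conjugating one cyclic ordering by the permutations of S that fix a chosen
point gives distinct cyclic orderings, since its centralizer is semiregular. *)
Lemma card_orderings_ge S : (1 < #|S|)%N -> (#|S|.-1)`! <= #|orderings S|.
Proof.
move=> S_gt1; have [r cr] := cyclic_ordering_exists S_gt1.
have [x Sx] : exists x, x \in S by apply/set0Pn; rewrite -card_gt0 ltnW.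
have <- : #|S :\ x| = #|S|.-1 by rewrite (cardsD1 x S) Sx.
have onS p : perm_on (S :\ x) p -> perm_on S p.
  by move/subset_trans; apply; apply: subsetDl.
rewrite -card_perm -(@card_in_imset _ _ (conjg r)) => [|p q Dp Dq /= eq_pq].
  apply/subset_leq_card/subsetP=> _ /imsetP[p Dp ->]; rewrite inE.
  by rewrite -(im_perm_on (onS p Dp)) cyclic_orderingJ.
have fix_x s : perm_on (S :\ x) s -> s x = x.
  by move=> Ds; apply: (out_perm Ds); rewrite !inE eqxx.
(* p * q^-1 centralizes r and fixes x, so it is trivial. *)
have rJ : r ^ (p * q^-1) = r by rewrite conjgM eq_pq conjgK.
have onSpq : perm_on S (p * q^-1).
  by rewrite perm_onM ?onS //; apply/perm_onV.
have [|y Sy|s rs def_s] := @cyclic_ordering_centralizer S r (p * q^-1) cr.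
- by move=> y Sy; rewrite perm_closed.
- have /permP/(_ y) : r * (p * q^-1) = (p * q^-1) * r by rewrite conjgC rJ.
  by rewrite !permM.
have s1 : s = 1.
  apply: (cyclic_ordering_free cr rs (group1 _) Sx).
  rewrite -def_s // perm1 permM fix_x //.
  by apply: (canLR (permK q)); rewrite fix_x.
apply/eqP; rewrite eq_mulgV1; apply/eqP/permP=> y.
have [Sy|S'y] := boolP (y \in S); first by rewrite def_s // s1.
by rewrite (out_perm onSpq) // perm1.
Qed.

Lemma card_orderings_le S : #|orderings S| <= (#|S|)`!.
Proof.
rewrite -card_perm; apply/subset_leq_card/subsetP=> r.
by rewrite inE => /cyclic_ordering_on.
Qed.

End CyclicOrderings.

(** * Automorphisms of Cayley maps *)

Section Automorphisms.

Variable R : finGroupType.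
Implicit Types (S : {set R}) (r f : {perm R}).
Import GroupScope.

(** An automorphism f carries the rotation at a to the rotation at f a. Both are
translates of r, so translating f back to the vertex 1 gives a map that commutes
with r on S. *)
Lemma map_aut_local S r f a :
    cyclic_ordering S r -> f \in map_aut (cayley_map S r) ->
  exists2 q, q \in <[r]> & {in S, forall s, f (s * a) = q s * f a}.
Proof.
move=> cr /map_autP[f_adj f_rot].
have [s Ss|s Ss|q rq def_q] :=
  @cyclic_ordering_centralizer _ S r (fun s => f (s * a) * (f a)^-1) cr.
- by have := f_adj a (s * a); rewrite /= /cayley_adj mulgK Ss.
- have /permP/(_ (f (s * a))) := f_rot a.
  rewrite conjgE !permM permK /= !permE mulgK => <-.
  by rewrite mulgK.
by exists q => // s Ss; rewrite -def_q // mulgKV.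
Qed.

(** For a in S, the vertex a and its neighbour 1 are both fixed, so f acts
trivially on the neighbourhood of a. Since S is more than half of R, every vertex
is adjacent to some a in S. *)
Lemma map_aut_fix S r f :
    cyclic_ordering S r -> S^-1 = S -> #|~: S| < #|S| ->
    f \in map_aut (cayley_map S r) -> f 1 = 1 -> {in S, forall s, f s = s} ->
  f = 1.
Proof.
move=> cr SV large autf f1 fS; apply/permP=> g; rewrite perm1.
have memV s : (s^-1 \in S) = (s \in S) by rewrite -{2}SV inE.
have [|a] := @exists_notin R [:: ~: S; (fun a => g * a^-1) @^-1: ~: S].
  rewrite !big_cons big_nil card_preimset; last by move=> x y /mulgI/invg_inj.
  by rewrite addn0 -(cardsC S) ltn_add2r.
rewrite /= !inE !negbK andbT => /andP[Sa Sga].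
have [q rq def_q] := map_aut_local a cr autf.
have q1 : q = 1.
  apply: (cyclic_ordering_free (x := a^-1) cr rq (group1 _)); rewrite ?memV //.
  by apply: (mulIg (f a)); rewrite -def_q ?memV // mulVg f1 perm1 fS // mulVg.
by rewrite -[g](mulgKV a) def_q // q1 perm1 fS.
Qed.

Definition right_mul (g : R) : {perm R} := perm (@mulIg R g).

Lemma right_mulM : {in [set: R] &, {morph right_mul : g h / g * h}}.
Proof. by move=> g h _ _; apply/permP=> x; rewrite permM !permE mulgA. Qed.

Canonical right_mul_morphism := Morphism right_mulM.

(** Any automorphism becomes one fixing 1 after composition with a right
multiplication. *)
Lemma is_MRR_stab1 S r :
    (forall f, f \in map_aut (cayley_map S r) -> f 1 = 1 -> f = 1) ->
  is_MRR S r.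
Proof.
move=> stab1; rewrite /is_MRR isog_sym.
apply/isogP; exists [morphism of right_mul].
  apply/injmP=> g h _ _ /permP/(_ 1).
  by rewrite !permE !mul1g.
apply/eqP; rewrite eqEsubset; apply/andP; split; apply/subsetP=> f.
  by case/morphimP=> g _ _ ->; apply: right_mul_map_aut.
move=> autf; apply/morphimP; exists (f 1); rewrite ?inE //=.
have {}stab1 : f * (right_mul (f 1))^-1 = 1.
  apply: stab1; first by rewrite groupM ?groupV //; apply: right_mul_map_aut.
  by rewrite permM; apply: (canLR (permK _)); rewrite permE mul1g.
by apply/eqP; rewrite eq_mulgV1 stab1.
Qed.

(** The trace on S of the identity of map_aut_local for an automorphism acting on S
as the power r^i; only products s * a that stay in S are constrained, so this is
a condition on r alone. *)
Definition skew_power S r i :=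
  [forall a in S, [exists q in <[r]>, [forall s in S,
     (s * a \in S) ==> ((r ^+ i) (s * a) == q s * (r ^+ i) a)]]].

Lemma skew_powerP S r i :
  reflect {in S, forall a, exists2 q, q \in <[r]> &
             {in S, forall s, s * a \in S ->
               (r ^+ i) (s * a) = q s * (r ^+ i) a}}
          (skew_power S r i).
Proof.
apply: (iffP forall_inP) => H a Sa.
  have /exists_inP[q rq /forall_inP Hq] := H a Sa.
  by exists q => // s Ss Ssa; apply/eqP; apply: (implyP (Hq s Ss)).
have [q rq Hq] := H a Sa; apply/exists_inP; exists q => //.
by apply/forall_inP=> s Ss; apply/implyP=> Ssa; rewrite Hq.
Qed.

(** The point of passing to exponents |S|/p is that few exponents suffice: the
union bound over primes costs a factor sqrt |S|, whereas one over all exponents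
would cost a factor |S| and cancel the gain. *)
Lemma skew_power_of_not_MRR S r :
    cyclic_ordering S r -> S^-1 = S -> #|~: S| < #|S| -> ~~ is_MRR S r ->
  exists2 p, p \in primes #|S| &
    (r ^+ (#|S| %/ p) != 1) && skew_power S r (#|S| %/ p).
Proof.
move=> cr SV large notMRR.
have [f autf [f1 fN1]] : exists2 f, f \in map_aut (cayley_map S r)
                                & f 1 = 1 /\ f != 1.
  have [/existsP[f /and3P[autf /eqP f1 fN1]]|no_f] :=
    boolP [exists f, [&& f \in map_aut (cayley_map S r), f 1 == 1 & f != 1]].
    by exists f.
  case/negP: notMRR; apply: is_MRR_stab1 => f autf f1; apply/eqP.
  by apply: contraR no_f => fN1; apply/existsP; exists f; rewrite autf f1 eqxx.
have S_gt0 : S != set0 by rewrite -card_gt0; lia.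
have or := order_cyclic_ordering cr S_gt0.
have [q rq] := map_aut_local 1 cr autf.
rewrite f1 => def_q; have {}def_q s : s \in S -> f s = q s.
  by move=> Ss; rewrite -[s in LHS]mulg1 def_q ?mulg1.
have q_gt1 : 1 < #[q].
  rewrite ltn_neqAle order_gt0 andbT eq_sym order_eq1.
  apply: contra fN1 => /eqP q1; apply/eqP.
  by apply: (map_aut_fix cr SV) => // s Ss; rewrite def_q // q1 perm1.
pose p := pdiv #[q]; have p_pr : prime p by apply: pdiv_prime.
have p_q : p %| #[q] by apply: pdiv_dvd.
have p_S : p %| #|S| by rewrite -or (dvdn_trans p_q) // order_dvdG.
have orderXp (x : {perm R}) : p %| #[x] -> #[x ^+ (#[x] %/ p)] = p.
  by move=> px; rewrite orderXdiv ?dvdn_div // divnA // mulKn.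
have ord_p : #[r ^+ (#|S| %/ p)] = p by rewrite -or orderXp ?or.
exists p; first by rewrite mem_primes p_pr card_gt0 S_gt0.
rewrite -order_eq1 ord_p neq_ltn prime_gt1 ?orbT //=.
(* The cyclic group generated by r has only one subgroup of order p. *)
have [u def_u] : exists u, r ^+ (#|S| %/ p) = q ^+ u.
  have /eqP eqG :
      <[r ^+ (#|S| %/ p)]> == <[q ^+ (#[q] %/ p)]>.
    rewrite (eq_subG_cyclic (cycle_cyclic r)) ?cycle_subG ?groupX ?cycle_id //.
    by rewrite -[#|_|]/(#[_]) ord_p -[#|_|]/(#[_]) orderXp.
  apply/cycleP/(subsetP (_ : <[q ^+ (#[q] %/ p)]> \subset _)).
    by rewrite cycle_subG mem_cycle.
  by rewrite -eqG cycle_id.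
have autfu : f ^+ u \in map_aut (cayley_map S r) by rewrite groupX.
have fuS s : s \in S -> (f ^+ u) s = (q ^+ u) s.
  move=> Ss; have Sr := cyclic_ordering_on cr.
  elim: u {def_u autfu} => [|u IH]; first by rewrite !expg0.
  by rewrite !expgSr !permM IH def_q // perm_closed //
    (perm_on_cycle Sr) ?groupX.
apply/skew_powerP=> a Sa; have [q' rq' Hq'] := map_aut_local a cr autfu.
by exists q' => // s Ss Ssa; rewrite def_u -!fuS // Hq'.
Qed.

End Automorphisms.

(** * Skew powers are rare *)

Section Rigidity.

Variable R : finGroupType.
Implicit Types (S D : {set R}) (r f q : {perm R}).
Import GroupScope.

Lemma conj_perm_out D f q x :
  perm_on D f -> x \notin D -> q x \notin D -> (q ^ f) x = q x.
Proof.
move=> Df D'x D'qx; rewrite conjgE !permM.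
by rewrite (out_perm (perm_onV Df)) // (out_perm Df).
Qed.

(** The powers r^i and (r^f)^i agree outside a few points. Given u in S, the number
12 leaves room to choose a vertex a, and then an s in S, such that, u and its
images aside, no point met in the computation lies in D. Comparing the two identities at s * a
shows that r and r^f use the same exponent at a; comparing them at
u = (u a^-1) * a gives equality at u. *)
Lemma skew_power_rigid S D r f i :
    cyclic_ordering S r -> D \subset S -> #|D| <= 3 -> #|~: S| + 12 < #|S| ->
    perm_on D f -> skew_power S r i -> skew_power S (r ^ f) i ->
  (r ^+ i) ^ f = r ^+ i.
Proof.
move=> cr DS cardD large Df /skew_powerP skew_r /skew_powerP skew_rf.
set h := r ^+ i; have Sr := cyclic_ordering_on cr.
have rih : (r ^ f) ^+ i = h ^ f by rewrite conjXg.
apply/permP=> u; apply/eqP/idPn => neq_u.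
have Su : u \in S.
  apply: contraR neq_u => S'u; have D'u := contra (subsetP DS u) S'u.
  have hu : h u = u by apply: (out_perm (perm_on_cycle Sr (mem_cycle _ _))).
  by rewrite (conj_perm_out Df) ?hu.
have [|a] := @exists_notin R [:: ~: S; D; h @^-1: D;
    (fun a => u * a^-1) @^-1: ~: S; (fun a => u * a^-1) @^-1: D;
    (fun a => h u * (h a)^-1) @^-1: D].
  rewrite !big_cons big_nil !card_preimset.
  - by rewrite -(cardsC S); move: cardD large; lia.
  - by move=> x y /mulgI/invg_inj/perm_inj.
  - by move=> x y /mulgI/invg_inj.
  - by move=> x y /mulgI/invg_inj.
  exact: perm_inj.
rewrite /= !inE !negbK andbT => /and5P[Sa D'a D'ha Sua /andP[D'ua D'hua]].
have hfa : (h ^ f) a = h a by rewrite (conj_perm_out Df).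
have [q rq def_q] := skew_r a Sa.
have [_ /cycleP[j ->] def_qf] := skew_rf a Sa.
have [|s] := @exists_notin R [:: ~: S; (fun s => s * a) @^-1: ~: S; D;
    (fun s => s * a) @^-1: D; (fun s => h (s * a)) @^-1: D;
    (fun s => h (s * a) * (h a)^-1) @^-1: D].
  rewrite !big_cons big_nil !card_preimset.
  - by rewrite -(cardsC S); move: cardD large; lia.
  - by move=> x y /mulIg/perm_inj/mulIg.
  - by move=> x y /perm_inj/mulIg.
  - exact: mulIg.
  exact: mulIg.
rewrite /= !inE !negbK andbT => /and5P[Ss Ssa D's D'sa /andP[D'hsa D'out]].
(* The exponents of the two local rotations at a agree, as they agree at s. *)
have def_qj : q = r ^+ j.
  apply: (cyclic_ordering_free cr rq (mem_cycle _ _) Ss); apply: (mulIg (h a)).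
  have eq_s : h (s * a) = ((r ^+ j) ^ f) s * h a.
    by rewrite -(conj_perm_out Df D'sa D'hsa) -rih def_qf // rih hfa conjXg.
  rewrite -(def_q s) // -/h eq_s; congr (_ * _).
  rewrite -{2}[r ^+ j](conjgK f) (conj_perm_out (perm_onV Df)) //.
  by move: D'out; rewrite eq_s mulgK.
have hu : h u = q (u * a^-1) * h a by rewrite -def_q ?mulgKV.
have hfu : (h ^ f) u = (q ^ f) (u * a^-1) * h a.
  by rewrite -{1}[u](mulgKV a) -rih def_qf ?mulgKV // rih hfa def_qj conjXg.
case/eqP: neq_u; rewrite hu hfu (conj_perm_out Df) //.
by move: D'hua; rewrite hu mulgK.
Qed.

Definition skew_orderings S i : {set {perm R}} :=
  [set r in orderings S | (r ^+ i != 1) && skew_power S r i].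

(** If two skew orderings had a common conjugate by transpositions (y z) and (y w)
with z <> w, then by rigidity the 3-cycle (y z) (y w) would commute with r^i. But
r^i has no fixed point on S and maps y neither to z nor z to y, so it cannot
permute {y, z, w} as it should. *)
Lemma card_skew_orderings S i : #|~: S| + 12 < #|S| ->
  #|skew_orderings S i| * (#|S| - 3) <= #|orderings S|.
Proof.
move=> large.
have [y Sy] : exists y, y \in S.
  by apply/set0Pn; rewrite -card_gt0 (leq_trans _ large).
pose Z r := S :\: [set y; (r ^+ i) y; (r ^+ i)^-1 y].
have leZ r : #|S| - 3 <= #|Z r|.
  rewrite cardsD leq_sub2l // (leq_trans (subset_leq_card (subsetIr _ _))) //.
  by rewrite -setUA cardsU1 cards2; do 2!case: (_ \notin _) || case: (_ != _).
have ZP r z : z \in Z r -> [/\ z \in S, z != y, (r ^+ i) y != z & (r ^+ i) z != y].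
  rewrite !inE !negb_or -!andbA => /and4P[zy zry zVy Sz]; split=> //.
    by rewrite eq_sym.
  by apply: contra zVy => /eqP<-; rewrite permK.
have skewP r : r \in skew_orderings S i ->
    [/\ cyclic_ordering S r, r ^+ i != 1 & skew_power S r i].
  by rewrite !inE => /and3P[].
pose A := [set rz : {perm R} * R |
            (rz.1 \in skew_orderings S i) && (rz.2 \in Z rz.1)].
have leA : #|skew_orderings S i| * (#|S| - 3) <= #|A|.
  rewrite -sum_nat_const.
  by rewrite card_dep_pairs; apply: leq_sum.
apply: leq_trans leA _.
rewrite -(@card_in_imset _ _ (fun rz : {perm R} * R => rz.1 ^ tperm y rz.2)).
  apply/subset_leq_card/subsetP=> _ /imsetP[[r z] + ->].
  rewrite inE => /andP[/skewP[cr _ _] /ZP[Sz _ _ _]]; rewrite inE.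
  rewrite -(@im_perm_on _ (tperm y z) S) ?cyclic_orderingJ //.
  apply: subset_trans (tperm_on y z) _.
  by apply/subsetP=> x; rewrite !inE => /orP[]/eqP->.
move=> [r z] [r2 w] /[1!inE] /andP[/skewP[cr r1 skew_r] /ZP[/= Sz zy ryNz rzNy]].
move=> /[1!inE] /andP[/skewP[_ _ skew_r2] /ZP[/= Sw wy _ _]] /= eq_rr2.
have def_r2 : r2 = r ^ (tperm y z * tperm y w).
  by rewrite conjgM eq_rr2 -conjgM tperm2 conjg1.
suff zw : z = w by rewrite def_r2 -zw tperm2 conjg1.
apply/eqP/idPn => zw.
pose D := [set y; z; w].
have commD : (r ^+ i) ^ (tperm y z * tperm y w) = r ^+ i.
  apply: (@skew_power_rigid S D) => //; last by rewrite -def_r2.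
  - by apply/subsetP=> x; rewrite !inE -orbA => /or3P[]/eqP->.
  - by rewrite /D -setUA cardsU1 cards2; do 2!case: (_ \notin _) || case: (_ != _).
  by apply: perm_onM; apply: subset_trans (tperm_on _ _) _;
    apply/subsetP=> x; rewrite !inE => /orP[]/eqP->; rewrite eqxx ?orbT.
have ryNy : (r ^+ i) y != y.
  apply: contra r1 => /eqP ryy.
  apply/eqP/(cyclic_ordering_free cr (mem_cycle _ _) (group1 _) Sy).
  by rewrite ryy perm1.
have rz : (r ^+ i) z = tperm y w ((r ^+ i) y).
  have /permP/(_ y) := conjgC (r ^+ i) (tperm y z * tperm y w).
  rewrite commD !permM tpermL (tpermD (z := z)) 1?eq_sym // => <-.
  by rewrite (tpermD (z := (r ^+ i) y)) // eq_sym.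
have [ryw|ryNw] := eqVneq ((r ^+ i) y) w.
  by case/eqP: rzNy; rewrite rz ryw tpermR.
case/eqP: zy; apply: (@perm_inj _ (r ^+ i)).
by rewrite rz tpermD // eq_sym.
Qed.

End Rigidity.

(** * Counting Cayley maps *)

Section Counting.

Lemma expn2_size_primes k : 0 < k -> 2 ^ size (primes k) <= k.
Proof.
move=> k_gt0; rewrite {2}(prod_prime_decomp k_gt0) /primes size_map.
have : {in prime_decomp k, forall f, 2 <= f.1 ^ f.2}.
  move=> [p e] /mem_prime_decomp[p_pr e_gt0 _] /=.
  by rewrite (leq_trans (prime_gt1 p_pr)) // -{1}[p]expn1 leq_exp2l ?prime_gt1.
elim: (prime_decomp k) => [|f s IH] s_ge2; first by rewrite big_nil.
rewrite big_cons /= expnS leq_mul ?s_ge2 ?mem_head //.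
by apply: IH => g s_g; apply: s_ge2; rewrite inE s_g orbT.
Qed.

Lemma sqrn_leq_expn2 m : m ^ 2 <= 2 * 2 ^ m.
Proof.
elim: m => [|[|[|[|m]]] IH] //; rewrite [2 ^ _]expnS; move: IH.
by move: (2 ^ m.+3) => x; rewrite -!mulnn; nia.
Qed.

(** A number k has at most sqrt(2k) distinct prime divisors. *)
Lemma size_primes_small M k : 2 * M ^ 2 + 6 <= k -> M * size (primes k) <= k - 3.
Proof.
move=> k_large; have k_gt0 : 0 < k by lia.
have := leq_trans (sqrn_leq_expn2 _) (leq_mul (leqnn 2) (expn2_size_primes k_gt0)).
move: (size _) => w w2; rewrite -leq_sqr expnMn.
apply: (@leq_trans (M ^ 2 * (2 * k))); first by rewrite leq_mul.
by move: k_large; set M2 := M ^ 2; rewrite -mulnn; nia.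
Qed.

Lemma fact_leq_mul m j : m`! * m.+1 ^ j <= (m + j)`!.
Proof.
elim: j => [|j IH]; first by rewrite muln1 addn0.
rewrite addnS factS expnS mulnCA leq_mul //; lia.
Qed.

(** With m = n/2 + 6, the factorial on the right exceeds m! by at least m - 14
factors, each of which is at least 64 = 2^6. *)
Lemma fact_half_small M n : 2 * M + 126 <= n ->
  2 ^ n * ((n./2 + 6)`! * M) <= (n - 2)`!.
Proof.
move=> n_large; set m := n./2 + 6.
have [j def_m] : exists j, m = j + M + 63.
  by exists (m - (M + 63)); have := odd_double_half n; lia.
have n_le : n <= 2 * m by have := odd_double_half n; lia.
have m_n : m + (j + M + 49) <= n - 2 by have := odd_double_half n; lia.
apply: leq_trans (leq_fact m_n); apply: leq_trans (fact_leq_mul _ _).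
rewrite mulnCA leq_mul2l; apply/orP; right.
have pow64 : 2 ^ (6 * (j + M + 49)) <= m.+1 ^ (j + M + 49).
  by rewrite expnM leq_exp2r ?addn_gt0 ?orbT //; lia.
apply: leq_trans pow64.
apply: (@leq_trans (2 ^ (2 * m) * 2 ^ M)).
  by rewrite leq_mul ?leq_exp2l // ltnW // ltn_expl.
by rewrite -expnD leq_exp2l //; lia.
Qed.

Variable R : finGroupType.
Implicit Types (S : {set R}) (r : {perm R}).
Import GroupScope.

Definition non_MRR_orderings S : {set {perm R}} :=
  [set r in orderings S | ~~ is_MRR S r].

(** The conditions on S alone in cayley_pair. *)
Definition connection_set S : bool :=
  [&& 1 \notin S, <<S>> == [set: R] & S^-1 == S].

Lemma cayley_pairE S r :
  cayley_pair S r = connection_set S && (r \in orderings S).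
Proof. by rewrite /cayley_pair /connection_set inE !andbA. Qed.

Lemma card_cayley_maps :
  #|cayley_maps R| = \sum_(S : {set R} | connection_set S) #|orderings S|.
Proof.
rewrite -card_dep_pairs; apply: eq_card => -[S r].
by rewrite !inE -[cyclic_ordering _ _]inE -cayley_pairE.
Qed.

Lemma card_not_MRRs :
  #|cayley_maps R :\: MRRs R|
    = \sum_(S : {set R} | connection_set S) #|non_MRR_orderings S|.
Proof.
rewrite -card_dep_pairs; apply: eq_card => -[S r]; rewrite !inE /= cayley_pairE.
by rewrite inE; case: (connection_set S); case: (cyclic_ordering S r);
  case: (is_MRR S r).
Qed.

(** The union bound over the prime divisors of |S|. *)
Lemma card_non_MRR_orderings S M :
    S^-1 = S -> #|~: S| + 12 < #|S| -> 2 * M ^ 2 + 6 <= #|S| ->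
  #|non_MRR_orderings S| * M <= #|orderings S|.
Proof.
move=> SV large M_small; have Mw := size_primes_small M_small.
set w := size _ in Mw.
have cover : #|non_MRR_orderings S| <=
    \sum_(p <- primes #|S|) #|skew_orderings S (#|S| %/ p)|.
  apply: (@leq_trans #|\bigcup_(p <- primes #|S|) skew_orderings S (#|S| %/ p)|).
    apply/subset_leq_card/subsetP=> r; rewrite !inE => /andP[cr notMRR].
    have [|p p_k] := skew_power_of_not_MRR cr SV _ notMRR.
      by apply: leq_ltn_trans large; apply: leq_addr.
    case/andP=> r1 skew_r; rewrite (big_rem p) //= inE; apply/orP; left.
    by rewrite !inE cr r1.
  elim: (primes _) => [|p s IH]; first by rewrite !big_nil cards0.
  by rewrite !big_cons (leq_trans (leq_card_setU _ _)) // leq_add2l.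
have : #|non_MRR_orderings S| * (#|S| - 3) <= w * #|orderings S|.
  apply: leq_trans (leq_mul cover (leqnn _)) _.
  have -> : (w * #|orderings S|)%N = \sum_(p <- primes #|S|) #|orderings S|.
    by rewrite big_const_seq count_predT iter_addn_0 mulnC.
  rewrite big_distrl /=.
  by apply: leq_sum => p _; apply: card_skew_orderings.
have [w0|w_gt0] := posnP w; first by move: large; rewrite w0; nia.
move: Mw w_gt0; move: #|non_MRR_orderings S| #|orderings S| => x t Mw w_gt0 le_xt.
by rewrite -(leq_pmul2l w_gt0) (leq_trans _ le_xt) // mulnCA leq_mul2l mulnC Mw orbT.
Qed.

(** The complete graph, S = R \ {1}, already gives this many. *)
Lemma card_cayley_maps_ge : 2 < #|R| -> (#|R| - 2)`! <= #|cayley_maps R|.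
Proof.
move=> R_gt2; rewrite card_cayley_maps.
have cardS : #|[set~ (1 : R)]| = (#|R| - 1)%N by rewrite cardsC1 subn1.
have connS : connection_set [set~ (1 : R)].
  apply/and3P; split; first by rewrite !inE eqxx.
    apply/eqP/setP=> g; rewrite inE; have [->|gN1] := eqVneq g 1.
      exact: group1.
    by rewrite mem_gen // !inE.
  by apply/eqP/setP=> g; rewrite !inE (can2_eq invgK invgK) invg1.
rewrite (bigD1 _ connS) /= (leq_trans _ (leq_addr _ _)) //.
have -> : (#|R| - 2 = #|[set~ (1%g : R)]|.-1)%N by rewrite cardS; lia.
by apply: card_orderings_ge; rewrite cardS; lia.
Qed.

(** Large S contribute at most card_cayley_maps to the left-hand side by
card_non_MRR_orderings, and so do all small S together by factorial growth. *)
Lemma card_not_MRRs_le M : 4 * M ^ 2 + 2 * M + 130 <= #|R| ->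
  #|cayley_maps R :\: MRRs R| * M <= 2 * #|cayley_maps R|.
Proof.
set n := #|R| => n_large.
rewrite card_not_MRRs big_distrl /=.
apply: (@leq_trans (\sum_(S : {set R} | connection_set S)
                      (#|orderings S| + (n./2 + 6)`! * M))).
  apply: leq_sum => S /and3P[_ _ /eqP SV].
  have card_all : (#|S| + #|~: S| = n)%N := cardsC S.
  have [small|large] := leqP #|S| (n./2 + 6).
    rewrite (leq_trans _ (leq_addl _ _)) // leq_mul2r; apply/orP; right.
    have : #|non_MRR_orderings S| <= #|orderings S|.
      by apply/subset_leq_card/subsetP=> r; rewrite inE => /andP[].
    by move/leq_trans; apply; apply: leq_trans (card_orderings_le S) (leq_fact small).
  rewrite (leq_trans _ (leq_addr _ _)) // card_non_MRR_orderings //.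
    by move: large; have := odd_double_half n; lia.
  by move: large; have := odd_double_half n; lia.
rewrite big_split /= -card_cayley_maps mul2n -addnn leq_add2l.
apply: leq_trans (card_cayley_maps_ge _); last by rewrite -/n; lia.
apply: leq_trans (fact_half_small (M := M) _); last by rewrite -/n; lia.
rewrite sum_nat_const leq_mul2r; apply/orP; right.
rewrite -/n -[n]cardsT -card_powerset.
by apply/subset_leq_card/subsetP=> S _; rewrite powersetE subsetT.
Qed.

End Counting.

Import Order.TTheory GRing.Theory Num.Theory.
Local Open Scope ring_scope.

Theorem theorem1p1 (K : realType) (eps : K) (eps_gt0 : 0 < eps) :
  exists N : nat, forall R : finGroupType, (N <= #|R|)%N ->
    #|MRRs R|%:R / #|cayley_maps R|%:R > 1 - eps.
Proof.
pose M := Num.bound (2 / eps).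
have M_large : 2 < eps * M%:R.
  have : 2 / eps < M%:R by apply: archi_boundP; rewrite divr_ge0 // ltW.
  by rewrite ltr_pdivrMr // mulrC.
exists (4 * M ^ 2 + 2 * M + 130)%N => R R_large.
have t_gt0 : (0 < #|cayley_maps R|)%N.
  by apply: leq_trans (card_cayley_maps_ge _); rewrite ?fact_gt0 //; lia.
have := card_not_MRRs_le R_large.
have /setIidPr subM : MRRs R \subset cayley_maps R.
  by apply/subsetP=> Sr; rewrite inE => /andP[].
rewrite cardsD subM; have : (#|MRRs R| <= #|cayley_maps R|)%N.
  by rewrite -subM subset_leq_card // subsetIl.
move: t_gt0; move: #|MRRs R| #|cayley_maps R| => m t t_gt0 le_mt.
rewrite ltr_pdivlMr ?ltr0n // -(ler_nat K) !natrM natrB // => le_M.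
have t0 : (0 : K) < t%:R by rewrite ltr0n.
rewrite ltNge; apply/negP => le_m.
have M0 : (0 : K) <= M%:R by rewrite ler0n.
have : eps * t%:R <= t%:R - m%:R by lra.
move/(ler_wpM2r M0); nra.
Qed.
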